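(* Let $\mathbb{F}$ be a field and let $\ominus$ be the uniform Kronecker difference given by a sequence of matrices $\upsilon_n\in\mathbb{F}_n$ with $\operatorname{tr}(\upsilon_n)=1$, $n\in\mathbb{N}$, via $$A\ominus B=\operatorname{tr}_{12}\bigl(\alpha_{m,n}^T(A\otimes I_m-I_m\otimes B\otimes I_m)\bigr),\qquad \alpha_{m,n}:=\sum_{i,j=1}^m E_{ij}\otimes\upsilon_n\otimes E_{ji},$$ for all $A\in\mathbb{F}_m\otimes\mathbb{F}_n$, $B\in\mathbb{F}_n$ and $m,n\in\mathbb{N}$. If $$(X\ominus Y)\ominus Z=X\ominus(Z\oplus Y)$$ for all $X\in\mathbb{F}_m\otimes\mathbb{F}_p\otimes\mathbb{F}_q$, $Y\in\mathbb{F}_q$, $Z\in\mathbb{F}_p$ and $m,p,q\in\mathbb{N}$, then for all $p,q\in\mathbb{N}$: $$\upsilon_{pq}=\upsilon_p\otimes\upsilon_q=\upsilon_q\otimes\upsilon_p.$$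
   Context: $\mathbb{F}_m$ is the space of $m\times m$ matrices over $\mathbb{F}$, $\mathbb{N}$ is the set of positive integers, $\otimes$ is the Kronecker product, and $\mathbb{F}_m\otimes\mathbb{F}_n$ is identified with $\mathbb{F}_{mn}$. $E_{ij}$ is the matrix unit with a $1$ in position $(i,j)$ and zeros elsewhere (here of size $m\times m$), and $I_m$ is the identity matrix. The Kronecker sum of $A\in\mathbb{F}_m$ and $B\in\mathbb{F}_n$ is $A\oplus B=A\otimes I_n+I_m\otimes B$. A Kronecker difference is a family of operations $\ominus:\mathbb{F}_{mn}\times\mathbb{F}_n\to\mathbb{F}_m$, indexed by $m,n\in\mathbb{N}$, such that $(A\oplus B)\ominus B=A$ for all $A\in\mathbb{F}_m$, $B\in\mathbb{F}_n$, $m,n\in\mathbb{N}$. It is uniform if $(A\oplus C)\ominus B=A\oplus(C\ominus B)$ for all $A\in\mathbb{F}_m$, $B\in\mathbb{F}_n$, $C\in\mathbb{F}_p\otimes\mathbb{F}_n$ and $m,n,p\in\mathbb{N}$, and moreover $(A+B)\ominus(C+D)=(A\ominus C)+(B\ominus D)$ and $(kA)\ominus(kC)=k(A\ominus C)$ for all matrices $A,B,C,D$ and scalars $k\in\mathbb{F}$ whenever the operations are defined. (The operation given by the displayed formula is always a uniform Kronecker difference.) $\operatorname{tr}_{12}:\mathbb{F}_m\otimes\mathbb{F}_n\otimes\mathbb{F}_m\to\mathbb{F}_m$ is the linear map with $\operatorname{tr}_{12}(A\otimes B\otimes C)=\operatorname{tr}(A)\operatorname{tr}(B)\,C$. *)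

(* Defs.v *)
From HB Require Import structures.
From mathcomp Require Import all_boot all_order all_algebra.
From mathcomp Require Export mxtens.
From mathcomp Require Import ring.

Set Implicit Arguments.
Unset Strict Implicit.
Unset Printing Implicit Defensive.

Import GRing.Theory.
Local Open Scope ring_scope.

(* F_m (x) F_n is 'M[F]_(m * n), with A (x) B = A *t B: the pair of indices
   (i, j) is sent to i * n + j (mxtens_index). With this convention the
   Kronecker product is strictly associative, except that m * (n * p) and
   m * n * p are not convertible types; sqcast transports a matrix along an
   equality of sizes, without changing any entry. *)
Definition sqcast (F : fieldType) (m n : nat) (e : m = n) (A : 'M[F]_m) :
  'M[F]_n := castmx (e, e) A.

Lemma tensmxA (F : fieldType) m n p (A : 'M[F]_m) (B : 'M[F]_n) (C : 'M[F]_p) :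
  sqcast (mulnA m n p) (A *t (B *t C)) = A *t B *t C.
Proof.
have idxA (i : 'I_m) (j : 'I_n) (k : 'I_p) :
    cast_ord (esym (mulnA m n p)) (mxtens_index (mxtens_index (i, j), k))
    = mxtens_index (i, mxtens_index (j, k)).
  by apply: val_inj; rewrite /= mulnDl mulnA addnA.
apply/matrixP => x y; rewrite castmxE.
case: (mxtens_indexP x) => x' k; case: (mxtens_indexP x') => i j {x x'}.
case: (mxtens_indexP y) => y' k'; case: (mxtens_indexP y') => i' j' {y y'}.
by rewrite !idxA !tensmxE mulrA.
Qed.

Definition kronecker_sum (F : fieldType) (m n : nat)
  (A : 'M[F]_m) (B : 'M[F]_n) : 'M[F]_(m * n) :=
  A *t (1%:M : 'M_n) + (1%:M : 'M_m) *t B.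

(* All the laws below are required for positive sizes only; the values of the
   family when m = 0 or n = 0 are irrelevant. *)
Definition kronecker_difference (F : fieldType)
  (ominus : forall m n : nat, 'M[F]_(m * n) -> 'M[F]_n -> 'M[F]_m) : Prop :=
  forall m n : nat, (0 < m)%N -> (0 < n)%N ->
  forall (A : 'M[F]_m) (B : 'M[F]_n), ominus m n (kronecker_sum A B) B = A.

Definition uniform_kronecker_difference (F : fieldType)
  (ominus : forall m n : nat, 'M[F]_(m * n) -> 'M[F]_n -> 'M[F]_m) : Prop :=
  [/\ kronecker_difference ominus,
      forall m n p : nat, (0 < m)%N -> (0 < n)%N -> (0 < p)%N ->
      forall (A : 'M[F]_m) (B : 'M[F]_n) (C : 'M[F]_(p * n)),
        ominus (m * p)%N n (sqcast (mulnA m p n) (kronecker_sum A C)) B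
        = kronecker_sum A (ominus p n C B),
      forall m n : nat, (0 < m)%N -> (0 < n)%N ->
      forall (A B : 'M[F]_(m * n)) (C D : 'M[F]_n),
        ominus m n (A + B) (C + D) = ominus m n A C + ominus m n B D
    & forall m n : nat, (0 < m)%N -> (0 < n)%N ->
      forall (k : F) (A : 'M[F]_(m * n)) (C : 'M[F]_n),
        ominus m n (k *: A) (k *: C) = k *: ominus m n A C].

Definition tr12 (F : fieldType) (m n p : nat) (M : 'M[F]_(m * n * p)) :
  'M[F]_p :=
  \matrix_(k, l) \sum_(i < m) \sum_(j < n)
    M (mxtens_index (mxtens_index (i, j), k))
      (mxtens_index (mxtens_index (i, j), l)).

(* As the products A *t B *t C span, the next two lemmas characterize tr12. *)
Lemma tr12_is_linear (F : fieldType) (m n p : nat) :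
  linear (@tr12 F m n p).
Proof.
move=> a M N; apply/matrixP => k l; rewrite !mxE big_distrr -big_split /=.
apply: eq_bigr => i _; rewrite big_distrr -big_split /=.
by apply: eq_bigr => j _; rewrite !mxE.
Qed.

HB.instance Definition _ (F : fieldType) (m n p : nat) :=
  GRing.isLinear.Build F 'M[F]_(m * n * p) 'M[F]_p _ (@tr12 F m n p)
    (@tr12_is_linear F m n p).

Lemma tr12_tens (F : fieldType) (m n p : nat)
  (A : 'M[F]_m) (B : 'M[F]_n) (C : 'M[F]_p) :
  tr12 (A *t B *t C) = (\tr A * \tr B) *: C.
Proof.
apply/matrixP => k l; rewrite !mxE /mxtrace mulr_suml mulr_suml.
apply: eq_bigr => i _; rewrite mulr_sumr mulr_suml.
by apply: eq_bigr => j _; rewrite !tensmxE.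
Qed.

Definition alpha (F : fieldType) (upsilon : forall n : nat, 'M[F]_n)
  (m n : nat) : 'M[F]_(m * n * m) :=
  \sum_(i < m) \sum_(j < m) delta_mx i j *t upsilon n *t delta_mx j i.

Definition kdiff (F : fieldType) (upsilon : forall n : nat, 'M[F]_n)
  (m n : nat) (A : 'M[F]_(m * n)) (B : 'M[F]_n) : 'M[F]_m :=
  tr12 ((alpha upsilon m n)^T *m
        (A *t (1%:M : 'M_m) - (1%:M : 'M_m) *t B *t (1%:M : 'M_m))).

Lemma sum_mxtens (F : fieldType) m n (f : 'I_(m * n) -> F) :
  \sum_x f x = \sum_(i < m) \sum_(j < n) f (mxtens_index (i, j)).
Proof.
rewrite pair_big /= (reindex (fun ij => @mxtens_index m n ij)) /=.
  by apply: eq_bigr => -[].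
by exists (@mxtens_unindex m n) => i _; rewrite (mxtens_indexK, mxtens_unindexK).
Qed.

Lemma alphaE (F : fieldType) (upsilon : forall n : nat, 'M[F]_n) m n
    (a c i k : 'I_m) (b j : 'I_n) :
  alpha upsilon m n (mxtens_index (mxtens_index (a, b), c))
                    (mxtens_index (mxtens_index (i, j), k))
  = (a == k)%:R * (c == i)%:R * upsilon n b j.
Proof.
rewrite /alpha summxE (bigD1 a) //= [X in _ + X]big1 => [|u ua]; last first.
  rewrite summxE big1 // => v _.
  by rewrite !tensmxE !mxE eq_sym (negbTE ua) !mul0r.
rewrite addr0 summxE (bigD1 i) //= [X in _ + X]big1 => [|v vi]; last first.
  by rewrite !tensmxE !mxE eqxx eq_sym (negbTE vi) !mul0r.
rewrite addr0 !tensmxE !mxE !eqxx mul1r [k == a]eq_sym mulrC andbC.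
by rewrite -mulnb natrM.
Qed.

Lemma kdiffE (F : fieldType) (upsilon : forall n : nat, 'M[F]_n) m n
    (A : 'M[F]_(m * n)) (B : 'M[F]_n) (k l : 'I_m) :
  kdiff upsilon A B k l =
  \sum_(j < n) \sum_(b < n) upsilon n b j *
    (A (mxtens_index (k, b)) (mxtens_index (l, j)) - (k == l)%:R * B b j).
Proof.
have H (M : 'M[F]_(m * n)) :
    tr12 ((alpha upsilon m n)^T *m (M *t (1%:M : 'M_m))) k l =
    \sum_(j < n) \sum_(b < n) upsilon n b j *
      M (mxtens_index (k, b)) (mxtens_index (l, j)).
  rewrite mxE (bigD1 l) //= [X in _ + X]big1 => [|i il]; last first.
    apply: big1 => j _; rewrite mxE sum_mxtens; apply: big1 => x _.
    apply: big1 => c _; rewrite mxE tensmxE !mxE.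
    case: (mxtens_indexP x) => a b; rewrite alphaE.
    have [->|] := eqVneq c i; first by rewrite (negbTE il) !mulr0.
    by rewrite mulr0 !mul0r.
  rewrite addr0; apply: eq_bigr => j _.
  rewrite mxE !sum_mxtens (bigD1 k) //= [X in _ + X]big1 => [|a ak]; last first.
    apply: big1 => b _; apply: big1 => c _.
    by rewrite mxE alphaE (negbTE ak) !mul0r.
  rewrite addr0; apply: eq_bigr => b _.
  rewrite (bigD1 l) //= [X in _ + X]big1 => [|c cl]; last first.
    by rewrite mxE alphaE (negbTE cl) mulr0 !mul0r.
  by rewrite addr0 mxE alphaE tensmxE !mxE !eqxx !mul1r mulr1.
have -> : kdiff upsilon A B =
    tr12 ((alpha upsilon m n)^T *m
          ((A - (1%:M : 'M_m) *t B) *t (1%:M : 'M_m))).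
  congr (tr12 (_ *m _)); apply/matrixP => x y; rewrite !mxE.
  by rewrite mulrDl mulNr.
rewrite H; apply: eq_bigr => j _; apply: eq_bigr => b _.
by congr (_ * _); rewrite mxE [X in _ + X]mxE tensmxE mxE.
Qed.

(* In particular the notion of uniform Kronecker difference is not vacuous. *)
Lemma kdiff_uniform (F : fieldType) (upsilon : forall n : nat, 'M[F]_n) :
  (forall n : nat, (0 < n)%N -> \tr (upsilon n) = 1) ->
  uniform_kronecker_difference (kdiff upsilon).
Proof.
move=> upsilon_tr.
have trE n (c : F) : (0 < n)%N ->
    \sum_(j < n) \sum_(b < n) upsilon n b j * (c * (b == j)%:R) = c.
  move=> n_gt0; transitivity (\tr (upsilon n) * c); last first.
    by rewrite upsilon_tr // mul1r.
  rewrite /mxtrace mulr_suml.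
  apply: eq_bigr => j _; rewrite (bigD1 j) //= [X in _ + X]big1 => [|b bj].
    by rewrite addr0 eqxx mulr1.
  by rewrite (negbTE bj) !mulr0.
split.
- move=> m n m_gt0 n_gt0 A B; apply/matrixP => k l.
  rewrite kdiffE -[RHS](trE n) //; apply: eq_bigr => j _; apply: eq_bigr => b _.
  by rewrite mxE !tensmxE !mxE addrK.
- move=> m n p m_gt0 n_gt0 p_gt0 A B C; apply/matrixP => x y.
  case: (mxtens_indexP x) => i k; case: (mxtens_indexP y) => j l {x y}.
  have idxA (a : 'I_m) (b : 'I_p) (c : 'I_n) :
      cast_ord (esym (mulnA m p n)) (mxtens_index (mxtens_index (a, b), c))
      = mxtens_index (a, mxtens_index (b, c)).
    by apply: val_inj; rewrite /= mulnDl mulnA addnA.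
  rewrite kdiffE [RHS]mxE !tensmxE kdiffE !mxE mulr_sumr.
  rewrite -[X in X + _](trE n) // -big_split; apply: eq_bigr => c _ /=.
  rewrite mulr_sumr -big_split; apply: eq_bigr => b _ /=.
  rewrite castmxE !idxA mxE !tensmxE !mxE.
  rewrite !(can_eq (@mxtens_indexK _ _)) !xpair_eqE -!mulnb !natrM.
  ring.
- move=> m n m_gt0 n_gt0 A B C D; apply/matrixP => k l.
  rewrite kdiffE [RHS]mxE !kdiffE -big_split; apply: eq_bigr => j _ /=.
  rewrite -big_split; apply: eq_bigr => b _ /=.
  rewrite !mxE; ring.
- move=> m n m_gt0 n_gt0 c A C; apply/matrixP => k l.
  rewrite kdiffE [RHS]mxE kdiffE mulr_sumr; apply: eq_bigr => j _ /=.
  rewrite mulr_sumr; apply: eq_bigr => b _ /=.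
  rewrite !mxE; ring.
Qed.

(* Main.v *)
(* Take m = 1 and Y = Z = 0 in the associativity hypothesis. Then X (-) 0 is the
   pairing of X with the matrix upsilon, so letting X run over the matrix units
   reads off the entries of upsilon_(pq) = upsilon_p (x) upsilon_q. The second
   equality follows because the left-hand side is symmetric in p and q. *)
Require Import Defs.
From mathcomp Require Import all_boot all_order all_algebra.
Import GRing.Theory.
Local Open Scope ring_scope.

Lemma kronecker_sum00 (F : fieldType) m n :
  kronecker_sum (0 : 'M[F]_m) (0 : 'M[F]_n) = 0.
Proof. by apply/matrixP => i j; rewrite !mxE mul0r mulr0 addr0. Qed.

Lemma sqcast_delta (F : fieldType) m n (e : m = n) (i j : 'I_m) :
  sqcast e (delta_mx i j : 'M[F]_m)
  = delta_mx (cast_ord e i) (cast_ord e j).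
Proof.
by case: n / e; rewrite /sqcast castmx_id !cast_ord_id.
Qed.

(** Commutativity of the size is all that relates [upsilon (q * p)] to [upsilon (p * q)]; this
    absorbs the resulting transport. *)
Lemma sqcast_family (F : fieldType) (f : forall n, 'M[F]_n) m n (e : m = n) :
  sqcast e (f m) = f n.
Proof. by case: n / e; rewrite /sqcast castmx_id. Qed.

(** Only the term with indices [b], [j] survives in [kdiffE]. The scalar [c] makes the result again
    an input of the same form, so that iterated differences can be computed. *)
Lemma kdiff_scale_delta (F : fieldType) (upsilon : forall n : nat, 'M[F]_n)
    m n (c : F) (k l : 'I_m) (b j : 'I_n) :
  kdiff upsilon
    (c *: delta_mx (mxtens_index (k, b)) (mxtens_index (l, j))) 0
  = (c * upsilon n b j) *: delta_mx k l.
Proof.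
apply/matrixP => k' l'; rewrite kdiffE.
under eq_bigr do under eq_bigr do
  rewrite !mxE mulr0 subr0 !(can_eq (@mxtens_indexK _ _)) !xpair_eqE.
rewrite (bigD1 j) //= [X in _ + X]big1 => [|j' /negbTE->]; last first.
  by apply: big1 => b' _; rewrite !andbF !mulr0.
rewrite addr0 (bigD1 b) //= [X in _ + X]big1 => [|b' /negbTE->]; last first.
  by rewrite !andbF !mulr0.
by rewrite addr0 !mxE !eqxx !andbT mulrCA mulrA.
Qed.

Theorem proposition5 (F : fieldType)
  (upsilon : forall n : nat, 'M[F]_n)
  (upsilon_tr : forall n : nat, (0 < n)%N -> \tr (upsilon n) = 1)
  (ominus : forall m n : nat, 'M[F]_(m * n) -> 'M[F]_n -> 'M[F]_m)
  (ominus_uniform : uniform_kronecker_difference ominus)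
  (ominus_given : forall m n : nat, (0 < m)%N -> (0 < n)%N ->
     forall (A : 'M[F]_(m * n)) (B : 'M[F]_n),
     ominus m n A B = kdiff upsilon A B)
  (ominus_assoc : forall m p q : nat, (0 < m)%N -> (0 < p)%N -> (0 < q)%N ->
     forall (X : 'M[F]_(m * p * q)) (Y : 'M[F]_q) (Z : 'M[F]_p),
     ominus m p (ominus (m * p)%N q X Y) Z =
       ominus m (p * q)%N (sqcast (esym (mulnA m p q)) X) (kronecker_sum Z Y)) :
  forall p q : nat, (0 < p)%N -> (0 < q)%N ->
    upsilon (p * q)%N = upsilon p *t upsilon q /\
    upsilon p *t upsilon q = sqcast (mulnC q p) (upsilon q *t upsilon p).
Proof.
have upsilonM p q : (0 < p)%N -> (0 < q)%N ->
    upsilon (p * q)%N = upsilon p *t upsilon q.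
  move=> p_gt0 q_gt0; apply/matrixP => x y.
  case: (mxtens_indexP x) => b c; case: (mxtens_indexP y) => i j {x y}.
  (* Both bracketings denote the position [u * q + v]. *)
  have idxA (u : 'I_p) (v : 'I_q) :
      cast_ord (esym (mulnA 1 p q))
        (mxtens_index (mxtens_index (ord0 : 'I_1, u), v))
      = mxtens_index (ord0 : 'I_1, mxtens_index (u, v)).
    by apply: val_inj; rewrite /= mulnDl mulnA addnA.
  pose X : 'M[F]_(1 * p * q) :=
    delta_mx (mxtens_index (mxtens_index (ord0, b), c))
             (mxtens_index (mxtens_index (ord0, i), j)).
  have := ominus_assoc 1%N p q isT p_gt0 q_gt0 X 0 0.
  rewrite !ominus_given ?mul1n ?muln_gt0 ?p_gt0 // kronecker_sum00.
  rewrite sqcast_delta !idxA -[delta_mx _ _]scale1r kdiff_scale_delta.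
  rewrite /X -[delta_mx _ _ in LHS]scale1r !kdiff_scale_delta.
  (* Both sides are multiples of the 1 x 1 matrix unit. The left coefficient lists the factor of
     [upsilon q] first, as [Y] is subtracted before [Z]; hence the final [mulrC]. *)
  move/matrixP/(_ ord0 ord0); rewrite !mxE !mxtens_indexK /= !mul1r !mulr1.
  by move=> <-; rewrite mulrC.
move=> p q p_gt0 q_gt0; split; first exact: upsilonM.
by rewrite -!upsilonM // sqcast_family.
Qed.
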